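(* Let $\beta\in[0,2]$, $m\in(0,2-\beta]$, $\lambda,\gamma\ge0$, $\alpha\in(-1,0]$, and let $a:\mathbb{R}^n\to(0,\infty)$ be a function satisfying $\inf_{\mathbb{R}^n}a>0$. Suppose that $u\in C(\mathbb{R}^n)$ is a viscosity solution to $$\Delta_\infty^\beta u=a(x)(|x|+1)^\alpha|\nabla u|^m+\lambda|u|^\gamma e^u\quad\text{in }\mathbb{R}^n .$$ If $$\lim_{R\to\infty}\frac{\mathrm{osc}_{B_R}u}{R}=0,\qquad\text{where } \mathrm{osc}_{B_R}u=\sup_{B_R}u-\inf_{B_R}u,$$ then $u$ is constant.
   Context: $B_R$ is the open ball of radius $R$ centered at $0$ in $\mathbb{R}^n$. For $\beta\in[0,2]$, $\Delta_\infty^\beta u=|\nabla u|^{-\beta}\langle D^2u\,\nabla u,\nabla u\rangle$; when $\beta<2$ this is read as $0$ at points where $\nabla u=0$. Viscosity subsolution (supersolution) of $\Delta_\infty^\beta u=F(x,u,\nabla u)$ in $\mathbb{R}^n$: $u$ is upper (lower) semicontinuous and, whenever $\varphi$ is $C^2$ and touches $u$ from above (below) at $x_0$, one has $\Delta_\infty^\beta\varphi(x_0)\ge(\le)\,F(x_0,u(x_0),\nabla\varphi(x_0))$; if $\beta=2$ and $\nabla\varphi(x_0)=0$, the term $\Delta_\infty^\beta\varphi(x_0)$ is replaced by the maximal (minimal) eigenvalue of $D^2\varphi(x_0)$. A viscosity solution is both. (The condition $m\in(0,2-\beta]$ is only possible when $\beta<2$.) *)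

(* Defs.v *)
From HB Require Import structures.
From mathcomp Require Import all_boot all_order all_algebra.
From mathcomp Require Import all_classical all_reals all_analysis.
Import Order.TTheory GRing.Theory Num.Theory.
Import numFieldNormedType.Exports.

Set Implicit Arguments.
Unset Strict Implicit.
Unset Printing Implicit Defensive.

Local Open Scope classical_set_scope.
Local Open Scope ring_scope.

Section Euclidean.
Context {R : realType} {n : nat}.
Implicit Types (x p : 'rV[R]_n) (u phi : 'rV[R]_n -> R) (r : R).

(* The library norm `|x| on 'rV[R]_n is the sup norm; it is used below only
   through the topology it induces, which is the usual one. *)
Definition edot x p : R := \sum_i x 0 i * p 0 i.

Definition enorm x : R := Num.sqrt (edot x x).

Definition eball r : set 'rV[R]_n := [set x | enorm x < r].

Definition osc (A : set 'rV[R]_n) u : R := sup (u @` A) - inf (u @` A).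

Definition partial (i : 'I_n) phi : 'rV[R]_n -> R :=
  fun x => 'D_(delta_mx 0 i) phi x.

Definition is_C1 phi : Prop :=
  forall i, (forall x, derivable phi x (delta_mx 0 i)) /\
            continuous (partial i phi).

Definition is_C2 phi : Prop :=
  is_C1 phi /\ forall i, is_C1 (partial i phi).

Definition grad phi x : 'rV[R]_n := \row_i partial i phi x.

Definition hess phi x : 'M[R]_n :=
  \matrix_(i, j) partial i (partial j phi) x.

(* For a nonempty real symmetric matrix the set of eigenvalues is finite and
   nonempty, so these are attained. *)
Definition max_eigenvalue (A : 'M[R]_n) : R := sup [set l | eigenvalue A l].
Definition min_eigenvalue (A : 'M[R]_n) : R := inf [set l | eigenvalue A l].

(* The operator as a function of the gradient p and the Hessian A, which acts
   on column vectors. The argument e is the value to be used at p = 0 when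
   beta = 2. *)
Definition inf_lap (beta e : R) p (A : 'M[R]_n) : R :=
  if p == 0 then (if beta == 2 then e else 0)
  else enorm p `^ (- beta) * edot (p *m A^T) p.

Definition inf_lap_max beta phi x : R :=
  inf_lap beta (max_eigenvalue (hess phi x)) (grad phi x) (hess phi x).

Definition inf_lap_min beta phi x : R :=
  inf_lap beta (min_eigenvalue (hess phi x)) (grad phi x) (hess phi x).

Definition touches_above phi u x0 : Prop :=
  phi x0 = u x0 /\ \forall x \near x0, u x <= phi x.

Definition touches_below phi u x0 : Prop :=
  phi x0 = u x0 /\ \forall x \near x0, phi x <= u x.

Definition visc_subsol (beta : R) (F : 'rV[R]_n -> R -> 'rV[R]_n -> R) u :=
  lower_semicontinuous (fun x => (- u x)%:E) /\
  forall phi x0, is_C2 phi -> touches_above phi u x0 ->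
    F x0 (u x0) (grad phi x0) <= inf_lap_max beta phi x0.

Definition visc_supersol (beta : R) (F : 'rV[R]_n -> R -> 'rV[R]_n -> R) u :=
  lower_semicontinuous (fun x => (u x)%:E) /\
  forall phi x0, is_C2 phi -> touches_below phi u x0 ->
    inf_lap_min beta phi x0 <= F x0 (u x0) (grad phi x0).

Definition visc_sol (beta : R) (F : 'rV[R]_n -> R -> 'rV[R]_n -> R) u :=
  visc_subsol beta F u /\ visc_supersol beta F u.

End Euclidean.

(* Main.v *)
Require Import Defs.
From mathcomp Require Import all_boot all_order all_algebra.
From mathcomp Require Import all_classical all_reals all_analysis.
From mathcomp Require Import ring lra.
Import Order.TTheory GRing.Theory Num.Theory.
Import numFieldNormedType.Exports.
Local Open Scope classical_set_scope.
Local Open Scope ring_scope.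

(* The right-hand side is nonnegative, so u is a subsolution of
   inf_lap u >= 0 and enjoys comparison with cones from above: a concave radial
   function A d - k d^2, d = |x - y|, k > 0, with nonzero gradient has negative
   operator, so u minus it has no interior maximum away from y in a ball around
   y. Since the oscillation of u is sublinear, for every A > 0 the perturbed
   cone with vertex y lies above u on the boundary of large balls, hence
   u x <= u y + A |x - y|; now let A tend to 0 and exchange x and y. *)

(** * Calculus of radial functions *)

Section RadialPolynomials.
Context {R : realType}.

(** Induction on [p] reduces this chain rule to the product rule, so a derivative of [f] along the
    single direction [v] suffices. *)
Lemma is_derive_horner (V : normedModType R) (p : {poly R}) (f : V -> R)
    (x v : V) (df : R) :
  is_derive x v f df ->
  is_derive x v (fun z => p.[f z]) (p^`().[f x] * df).
Proof.
move=> dfx; elim/poly_ind: p => [|p c dpx].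
  rewrite (_ : (fun _ => _) = cst 0); last by apply/funext=> z; rewrite hornerC.
  by rewrite derivC hornerC mul0r; exact: is_derive_cst.
rewrite (_ : (fun _ => _) = (fun z => p.[f z]) * f + cst c); last first.
  by apply/funext=> z; rewrite !hornerE.
apply: is_derive_eq.
by rewrite derivMXaddC !hornerE /GRing.scale /=; ring.
Qed.

Context {n : nat}.
Implicit Types (x y v : 'rV[R]_n) (p : {poly R}).

Lemma is_derive_coord x v (i : 'I_n) :
  is_derive x v (fun z : 'rV[R]_n => z 0 i) (v 0 i).
Proof.
have lim_v : (fun h : R => h^-1 *: ((h *: v + x) 0 i - x 0 i)) @ 0^' --> v 0 i.
  apply: cvg_near_cst; near=> h.
  have h0 : h != 0 by near: h; exact: nbhs_dnbhs_neq.
  by rewrite !mxE addrK /GRing.scale /= mulKf.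
by apply: DeriveDef; [apply/cvg_ex; exists (v 0 i)|exact: cvg_lim].
Unshelve. all: by end_near. Qed.

Definition sqdist y x : R := edot (x - y) (x - y).

Lemma sqdistE y x : sqdist y x = \sum_i (x 0 i - y 0 i) ^+ 2.
Proof. by apply: eq_bigr => i _; rewrite !mxE expr2. Qed.

Lemma sqdist_ge0 y x : 0 <= sqdist y x.
Proof. by rewrite sqdistE sumr_ge0// => i _; rewrite sqr_ge0. Qed.

Lemma enorm_sqr x : enorm x ^+ 2 = edot x x.
Proof. by rewrite sqr_sqrtr// -[x]subr0 sqdist_ge0. Qed.

Lemma coord_sqr_le_sqdist y x i : (x 0 i - y 0 i) ^+ 2 <= sqdist y x.
Proof.
by rewrite sqdistE (bigD1 i)//= lerDl sumr_ge0// => j _; rewrite sqr_ge0.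
Qed.

Lemma sqdist_eq0 y x : sqdist y x = 0 -> x = y.
Proof.
move=> s0; apply/rowP => i; apply/eqP; rewrite -subr_eq0 -sqrf_eq0.
by rewrite eq_le sqr_ge0 -s0 coord_sqr_le_sqdist.
Qed.

Lemma is_derive_sqdist y x v :
  is_derive x v (sqdist y) (2 * edot (x - y) v).
Proof.
rewrite (_ : sqdist y =
    \sum_i ((fun z : 'rV[R]_n => z 0 i) - cst (y 0 i)) ^+ 2); last first.
  by apply/funext => z; rewrite sqdistE fct_sumE; apply: eq_bigr.
have dcoord i := is_derive_coord x v i.
apply: is_derive_eq; rewrite /edot mulr_sumr; apply: eq_bigr => i _.
by rewrite /GRing.scale /= !mxE /= expr1 subr0 mulrA.
Qed.

Lemma continuous_coord_sub y (i : 'I_n) :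
  continuous (fun x : 'rV[R]_n => x 0 i - y 0 i).
Proof.
have c : continuous (fun x : 'rV[R]_n => x 0 i) by exact: coord_continuous.
by move=> x; exact: (cvgB (c x) (cvg_cst _)).
Qed.

Lemma continuous_sqdist y : continuous (sqdist y).
Proof.
rewrite (_ : sqdist y =
    fun x => \sum_i (x 0 i - y 0 i) * (x 0 i - y 0 i)); last first.
  by apply/funext => x; apply: eq_bigr => i _; rewrite !mxE.
elim: (index_enum _) => [|i r IH].
  by under eq_fun do rewrite big_nil; exact: cst_continuous.
under eq_fun do rewrite big_cons.
have c := continuous_coord_sub y i.
by move=> x; exact: (cvgD (cvgM (c x) (c x)) (IH x)).
Qed.

(** Polynomials in the squared distance are smooth at the vertex too; test functions have to be C^2
    on the whole space. *)
Definition radial p y x : R := p.[sqdist y x].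

Lemma continuous_radial p y : continuous (radial p y).
Proof.
move=> x; apply: continuous_comp; first exact: continuous_sqdist.
exact: continuous_horner.
Qed.

Lemma is_derive_radial p y x v :
  is_derive x v (radial p y) (radial p^`() y x * (2 * edot (x - y) v)).
Proof. by apply: is_derive_horner; exact: is_derive_sqdist. Qed.

Lemma edot_delta x i : edot x (delta_mx 0 i) = x 0 i.
Proof.
rewrite /edot (bigD1 i)//= big1 => [|j ji].
  by rewrite mxE !eqxx addr0 mulr1.
by rewrite mxE (negPf ji) andbF mulr0.
Qed.

Lemma partial_radial p y i :
  partial i (radial p y) =
  fun x => radial p^`() y x * (2 * (x 0 i - y 0 i)).
Proof.
apply/funext => x; rewrite /partial.
have [_ ->] := is_derive_radial p y x (delta_mx 0 i).
by rewrite edot_delta !mxE.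
Qed.

Lemma is_derive_partial_radial p y x i j :
  is_derive x (delta_mx 0 j) (partial i (radial p y))
    (4 * radial p^`()^`() y x * (x 0 j - y 0 j) * (x 0 i - y 0 i) +
     2 * radial p^`() y x * (i == j)%:R).
Proof.
rewrite partial_radial.
have dr := is_derive_radial p^`() y x (delta_mx 0 j).
have dc := is_derive_coord x (delta_mx 0 j) i.
rewrite (_ : (fun _ => _) =
    radial p^`() y * (2 *: ((fun z : 'rV[R]_n => z 0 i) - cst (y 0 i))))//.
apply: is_derive_eq; rewrite edot_delta !mxE eqxx /= /GRing.scale /=.
rewrite -[2 *: _]/(2 * (x 0 i - y 0 i)); ring.
Qed.

Lemma is_C2_radial p y : is_C2 (radial p y).
Proof.
have cd i := continuous_coord_sub y i.
have cc (c : R) : continuous (fun _ : 'rV[R]_n => c) by exact: cst_continuous.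
split=> [i|j i]; split.
- by move=> x; have [] := is_derive_radial p y x (delta_mx 0 i).
- rewrite partial_radial => x.
  exact: (cvgM (continuous_radial p^`() y x) (cvgM (cc 2 x) (cd i x))).
- by move=> x; have [] := is_derive_partial_radial p y x j i.
- rewrite (_ : partial i _ = fun x => 4 * radial p^`()^`() y x *
      (x 0 i - y 0 i) * (x 0 j - y 0 j) +
      2 * radial p^`() y x * (j == i)%:R); last first.
    by apply/funext => x; have [_ <-] := is_derive_partial_radial p y x j i.
  move=> x.
  have c1 := continuous_radial p^`() y x.
  have c2 := continuous_radial p^`()^`() y x.
  exact: (cvgD (cvgM (cvgM (cvgM (cc 4 x) c2) (cd i x)) (cd j x))
               (cvgM (cvgM (cc 2 x) c1) (cvg_cst _))).
Qed.

Lemma grad_radial p y x :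
  grad (radial p y) x = (2 * radial p^`() y x) *: (x - y).
Proof. by apply/rowP => i; rewrite !mxE partial_radial; ring. Qed.

Lemma hess_radial p y x :
  hess (radial p y) x =
  (4 * radial p^`()^`() y x) *: ((x - y)^T *m (x - y)) +
  (2 * radial p^`() y x)%:M.
Proof.
apply/matrixP => i j; rewrite !mxE big_ord1 !mxE {1}/partial.
have [_ ->] := is_derive_partial_radial p y x j i.
by rewrite eq_sym mulr_natr -!mulrA.
Qed.

Lemma edotC x y : edot x y = edot y x.
Proof. by apply: eq_bigr => i _; rewrite mulrC. Qed.

Lemma edotZ c x y : edot (c *: x) y = c * edot x y.
Proof.
by rewrite /edot mulr_sumr; apply: eq_bigr => i _; rewrite mxE mulrA.
Qed.

(** The gradient is parallel to [x - y], and the Hessian multiplies it by [4 p'' s + 2 p'], where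
    [s = d^2]. This factor is the second derivative of [p(d^2)] in [d]. *)
Lemma hess_grad_radial p y x :
  let P := grad (radial p y) x in
  edot (P *m (hess (radial p y) x)^T) P =
  4 * (radial p^`() y x) ^+ 2 * sqdist y x *
    (4 * radial p^`()^`() y x * sqdist y x + 2 * radial p^`() y x).
Proof.
rewrite /= grad_radial hess_radial.
rewrite (_ : (_ + _)^T = (4 * radial p^`()^`() y x) *: ((x - y)^T *m (x - y)) +
    (2 * radial p^`() y x)%:M); last first.
  by apply/matrixP => i j; rewrite !mxE !big_ord1 !mxE eq_sym [X in _ * X]mulrC.
rewrite mulmxDr mul_mx_scalar -scalemxAr -!scalemxAl mulmxA.
rewrite (_ : (x - y) *m (x - y)^T = (sqdist y x)%:M); last first.
  apply/matrixP => i j; rewrite !ord1 !mxE mulr1n.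
  by apply: eq_bigr => k _; rewrite !mxE.
rewrite mul_scalar_mx !scalerA -scalerDl edotZ edotC edotZ.
by rewrite -/(sqdist y x); ring.
Qed.

End RadialPolynomials.

(** * Comparison with perturbed cones *)

Section Comparison.
Context {R : realType} {n : nat}.
Implicit Types (x y : 'rV[R]_n) (u : 'rV[R]_n -> R).

(** Boundedness is checked in the sup norm: each coordinate of [x - y] is at most [|r|] in absolute
    value. *)
Lemma compact_sqdist_le y (r : R) : compact [set x | sqdist y x <= r ^+ 2].
Proof.
apply: bounded_closed_compact.
  exists (`|r| + `|y|); split=> [|M ltM x /= xr]; first exact: num_real.
  rewrite -(subrK y x) (le_trans (ler_normD _ _))// (le_trans _ (ltW ltM))//.
  rewrite lerD2r [leLHS]/Num.Def.normr /= mx_normrE.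
  apply: bigmax_le => //= -[i j] _ /=.
  rewrite !mxE (ord1 i) -ler_sqr ?nnegrE// !real_normK ?num_real//.
  exact: le_trans (coord_sqr_le_sqdist y x j) xr.
apply: (preimage_closed _ (@closed_le _ _)) => x _.
exact: continuous_sqdist.
Qed.

(* The third-order Taylor polynomial of the square root at 1, taken at q^2. *)
Lemma le_sqrt_taylor3 (q : R) :
  q <= 16^-1 * (5 + 15 * q ^+ 2 - 5 * q ^+ 4 + q ^+ 6).
Proof.
rewrite -subr_ge0 (_ : _ - _ = 16^-1 * ((q - 1) ^+ 4 * ((q + 2) ^+ 2 + 1))).
  by rewrite mulr_ge0// mulr_ge0 ?addr_ge0 ?sqr_ge0// (exprM _ 2 2) sqr_ge0.
by field.
Qed.

Let horner_simp :=
  (hornerD, hornerN, hornerZ, hornerMn, hornerC, hornerXn, hornerX).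

Let deriv_simp := (derivD, derivN, derivZ, derivMn, derivC, derivXn, derivX).

(* In the variable s = d^2 this is c + A T(s) - k s, where T is the third-order
   Taylor polynomial of the square root at r^2; it provides a globally C^2 test
   function touching c + A d - k d^2 from above on the sphere d = r. *)
Definition cone_poly (c A k r : R) : {poly R} :=
  (c + A * r * (5 / 16))%:P + (15 / 16 * A / r - k) *: 'X
  - (5 / 16 * A / r ^+ 3) *: 'X^2 + (16^-1 * A / r ^+ 5) *: 'X^3.

(** This is [le_sqrt_taylor3] at [q = t / r], scaled by [A * r]. Order three is the right one: the
    second-order polynomial crosses the square root at the contact point, and the first-order one
    loses the second derivative. *)
Lemma cone_poly_ge (c A k r s : R) : 0 <= A -> 0 < r -> 0 <= s ->
  c + A * Num.sqrt s - k * s <= (cone_poly c A k r).[s].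
Proof.
move=> A0 r0 s0; set t := Num.sqrt s; have -> : s = t ^+ 2 by rewrite sqr_sqrtr.
rewrite (_ : (cone_poly c A k r).[t ^+ 2] = c + A * r * (16^-1 *
    (5 + 15 * (t / r) ^+ 2 - 5 * (t / r) ^+ 4 + (t / r) ^+ 6)) - k * t ^+ 2).
  rewrite lerD2r lerD2l -mulrA ler_wpM2l// -ler_pdivrMl// mulrC.
  exact: le_sqrt_taylor3.
by rewrite /cone_poly !horner_simp; field; rewrite gt_eqF.
Qed.

Lemma cone_poly_at (c A k r : R) : 0 < r ->
  (cone_poly c A k r).[r ^+ 2] = c + A * r - k * r ^+ 2.
Proof.
by move=> r0; rewrite /cone_poly !horner_simp; field; rewrite gt_eqF.
Qed.

Lemma deriv_cone_poly_at (c A k r : R) : 0 < r ->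
  (cone_poly c A k r)^`().[r ^+ 2] = A / (2 * r) - k.
Proof.
move=> r0; rewrite /cone_poly !deriv_simp.
rewrite ?horner_simp /=.
by field; rewrite gt_eqF.
Qed.

Lemma deriv2_cone_poly_at (c A k r : R) : 0 < r ->
  (cone_poly c A k r)^`()^`().[r ^+ 2] = - A / (4 * r ^+ 3).
Proof.
move=> r0; rewrite /cone_poly !deriv_simp.
rewrite ?horner_simp /=.
by field; rewrite gt_eqF.
Qed.

(* The radial second derivative of A r - k r^2 is - 2 k < 0, so the operator is
   negative on the test function. *)
Lemma subsol_not_touched_by_cone (beta : R)
    (F : 'rV[R]_n -> R -> 'rV[R]_n -> R) u y x0 (A k : R) :
  (forall x r p, 0 <= F x r p) -> visc_subsol beta F u -> x0 != y ->
  0 <= A -> 0 < k -> 2 * k * Num.sqrt (sqdist y x0) < A ->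
  ~ (\forall x \near x0,
      u x - (A * Num.sqrt (sqdist y x) - k * sqdist y x) <=
      u x0 - (A * Num.sqrt (sqdist y x0) - k * sqdist y x0)).
Proof.
move=> F0 [_ sub] x0y A0 k0 kA umax.
set s0 := sqdist y x0 in kA umax *; set r := Num.sqrt s0 in kA umax *.
have s0_gt0 : 0 < s0.
  rewrite lt_def sqdist_ge0 andbT; apply: contra x0y => /eqP s0E.
  by rewrite (sqdist_eq0 _ _ s0E).
have r0 : 0 < r by rewrite sqrtr_gt0.
have s0E : s0 = r ^+ 2 by rewrite sqr_sqrtr// ltW.
(* With this [c] the polynomial agrees with [u] at [x0]; nearby, [u] lies below the shifted cone,
   which lies below the polynomial. *)
pose c := u x0 - (A * r - k * s0).
pose p := cone_poly c A k r.
have touch : touches_above (radial p y) u x0.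
  split; first by rewrite /radial -/s0 s0E cone_poly_at// /c s0E; ring.
  apply: filterS umax => x; rewrite -/c lerBlDr addrA => /le_trans; apply.
  by apply: cone_poly_ge => //; exact: sqdist_ge0.
have := sub _ _ (is_C2_radial p y) touch.
apply/negP; rewrite -ltNge; apply: (lt_le_trans _ (F0 _ _ _)).
have d1 : radial p^`() y x0 = A / (2 * r) - k.
  by rewrite /radial -/s0 s0E deriv_cone_poly_at.
(* The bound [2 * k * r < A] says that [A d - k d^2] still increases at [d = r]. Hence the gradient
   is nonzero, and the special values of [inf_lap] at zero gradient do not arise. *)
have d1_gt0 : 0 < radial p^`() y x0.
  by rewrite d1 subr_gt0 ltr_pdivlMr ?mulr_gt0// mulrCA mulrA.
rewrite /inf_lap_max /inf_lap hess_grad_radial grad_radial.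
rewrite scaler_eq0 subr_eq0 (negPf x0y) orbF gt_eqF ?mulr_gt0//.
rewrite pmulr_rlt0; last first.
  rewrite powR_gt0// sqrtr_gt0 edotZ edotC edotZ -/(sqdist y x0) -/s0.
  by rewrite !mulr_gt0.
rewrite pmulr_rlt0; last by rewrite !mulr_gt0// exprn_gt0.
rewrite -/s0 d1 /radial -/s0 s0E deriv2_cone_poly_at//.
(* The contributions of [A], namely [- A / r] and [A / r], cancel. *)
rewrite (_ : _ + _ = - (2 * k)) ?oppr_lt0 ?mulr_gt0//.
by field; rewrite gt_eqF.
Qed.

(** The difference [w] of [u] and the perturbed cone without its constant [u y] attains its maximum
    over the closed ball. An interior maximum away from [y] is excluded by
    [subsol_not_touched_by_cone]; at [y] the value is [u y], and on the sphere it is at most [u y]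
    by assumption. *)
Lemma subsol_le_cone (beta : R)
    (F : 'rV[R]_n -> R -> 'rV[R]_n -> R) u y
    (A k rho : R) :
  continuous u -> (forall x r p, 0 <= F x r p) -> visc_subsol beta F u ->
  0 < k -> 0 < rho -> 2 * k * rho < A ->
  (forall x, sqdist y x = rho ^+ 2 -> u x <= u y + A * rho - k * rho ^+ 2) ->
  forall x, sqdist y x <= rho ^+ 2 ->
  u x <= u y + A * Num.sqrt (sqdist y x) - k * sqdist y x.
Proof.
move=> cu F0 sub k0 rho0 kA bnd.
have A0 : 0 <= A by rewrite (le_trans _ (ltW kA))// !mulr_ge0// ltW.
pose w x := u x - (A * Num.sqrt (sqdist y x) - k * sqdist y x).
have cw : continuous w.
  have cc (c : R) : continuous (fun _ : 'rV[R]_n => c) by exact: cst_continuous.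
  have cs : continuous (fun x => Num.sqrt (sqdist y x)).
    move=> x; apply: continuous_comp; first exact: continuous_sqdist.
    exact: sqrt_continuous.
  move=> x.
  exact: (cvgB (cu x) (cvgB (cvgM (cc A x) (cs x))
                            (cvgM (cc k x) (continuous_sqdist y x)))).
have sqyy : sqdist y y = 0.
  by rewrite sqdistE big1// => i _; rewrite subrr expr0n.
have wy : w y = u y by rewrite /w sqyy sqrtr0 !mulr0 !subr0.
pose K := [set x | sqdist y x <= rho ^+ 2].
have [| |x0 /set_mem x0K wmax] := @compact_EVT_max _ _ w K _
    (compact_sqdist_le y rho).
- by exists y; rewrite /K /= sqyy sqr_ge0.
- exact: continuous_subspaceT.
have {}wmax x : sqdist y x <= rho ^+ 2 -> w x <= w x0.
  by move=> xK; apply: wmax; rewrite inE.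
suff wx0 : w x0 <= u y.
  by move=> x /wmax /le_trans /(_ wx0); rewrite lerBlDr addrA.
have [->|x0y] := eqVneq x0 y; first by rewrite wy.
move: x0K; rewrite /K /= le_eqVlt => /predU1P[x0K|x0K].
  rewrite lerBlDr x0K sqrtr_sqr gtr0_norm//.
  by rewrite addrA bnd.
exfalso; apply: (@subsol_not_touched_by_cone beta F u y x0 A k) => //.
  apply: le_lt_trans kA; rewrite ler_wpM2l//; first by rewrite mulr_ge0// ltW.
  by rewrite ltW// -[ltRHS]gtr0_norm// -sqrtr_sqr ltr_sqrt// exprn_gt0.
have near_lt : \forall x \near x0, sqdist y x < rho ^+ 2.
  exact: (cvgr_lt _ (continuous_sqdist y x0)).
by apply: filterS near_lt => x /ltW /wmax.
Qed.

(** * Oscillation and sublinear growth *)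

(** As [sup] and [inf] are meaningful only for bounded sets, boundedness of [u] is first drawn from
    compactness of the closed ball. *)
Lemma sub_le_osc u (r : R) x y : continuous u ->
  eball r x -> eball r y -> u x - u y <= osc (eball r) u.
Proof.
move=> cu xr yr.
have r0 : 0 < r by rewrite (le_lt_trans _ xr)// sqrtr_ge0.
have sub : u @` eball r `<=` u @` [set x | sqdist 0 x <= r ^+ 2].
  apply: image_subset => z zr.
  by rewrite /= /sqdist subr0 -enorm_sqr ler_sqr ?nnegrE ?sqrtr_ge0 ?ltW.
have [M [_ uM]] : bounded_set (u @` [set x | sqdist 0 x <= r ^+ 2]).
  apply/compact_bounded/continuous_compact; last exact: compact_sqdist_le.
  exact: continuous_subspaceT.
have {}uM z : eball r z -> `|u z| <= M + 1.
  by move=> zr; apply: (uM (M + 1)); [rewrite ltrDl|apply: sub; exists z].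
apply: lerB.
- apply: ub_le_sup; last by exists x.
  by exists (M + 1) => _ [z /uM zM <-]; rewrite (le_trans (ler_norm _)).
- apply: ge_inf; last by exists y.
  by exists (- (M + 1)) => _ [z /uM + <-]; rewrite ler_norml => /andP[].
Qed.

Lemma mem_eball x (r : R) : 0 < r -> edot x x < r ^+ 2 -> eball r x.
Proof.
move=> r0 xr; rewrite /eball /=.
by rewrite -(gtr0_norm r0) -sqrtr_sqr ltr_sqrt// exprn_gt0.
Qed.

(** The difference of the two sides is the squared length of [x - 2 y]. The bound serves to place
    balls around [y] inside balls around the origin. *)
Lemma edot_le_sqdist x y : edot x x <= 2 * sqdist y x + 2 * edot y y.
Proof.
rewrite sqdistE /edot !mulr_sumr -big_split /=; apply: ler_sum => i _.
rewrite -subr_ge0 (_ : _ - _ = (x 0 i - 2 * y 0 i) ^+ 2) ?sqr_ge0//; ring.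
Qed.

Lemma subsol_sublinear_le (beta : R)
    (F : 'rV[R]_n -> R -> 'rV[R]_n -> R) u x y :
  continuous u -> (forall x r p, 0 <= F x r p) -> visc_subsol beta F u ->
  osc (eball r) u / r @[r --> +oo] --> 0 -> u x <= u y.
Proof.
move=> cu F0 sub oscu; apply/ler_addgt0Pr => e e0.
(* With this slope the cone rises by at most [e] between [y] and [x]; the [+ 1] covers [x = y]. *)
pose A := e / (Num.sqrt (sqdist y x) + 1).
have d1 : 0 < Num.sqrt (sqdist y x) + 1 by rewrite ltr_wpDl ?sqrtr_ge0.
have A0 : 0 < A by rewrite divr_gt0.
pose e' := A / 4; have e'0 : 0 < e' by rewrite divr_gt0.
have osc_le : \forall r \near +oo, osc (eball r) u <= e' * r.
  have oscr := cvgr_lt _ oscu _ e'0.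
  near=> r.
  have r0 : 0 < r by near: r; exact: nbhs_pinfty_gt.
  by rewrite -ler_pdivrMr// ltW//; near: r; exact: oscr.
(* For [rho = r / 2 > 1], the second bound gives [sqdist y x < rho <= rho ^+ 2]. The third puts the
   closed ball of radius [rho] around [y] inside [eball r], since [2 rho^2 + 2 rho < 4 rho^2]. *)
have [r [r1 rx ry oscr]] : exists r : R, [/\ 2 < r, 2 * sqdist y x < r,
    2 * edot y y < r & osc (eball r) u <= e' * r].
  near (pinfty_nbhs R) => r; exists r.
  by split; near: r => //; apply: nbhs_pinfty_gt; exact: num_real.
(* Since [k * rho = A / 4], the perturbed cone increases up to [rho] and has risen there by
   [3/4 A rho], more than the oscillation bound [e' * r = A rho / 2]. *)
pose rho := r / 2; pose k := A / (4 * rho).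
have rho1 : 1 < rho by rewrite /rho; lra.
have rE : r = 2 * rho by rewrite /rho; field.
have rho0 : 0 < rho by lra.
have k0 : 0 < k by rewrite divr_gt0// mulr_gt0.
have kE : k * rho = A / 4 by rewrite /k; field; rewrite gt_eqF.
have xrho : sqdist y x <= rho ^+ 2 by rewrite expr2; nra.
have yr z : sqdist y z <= rho ^+ 2 -> eball r z.
  move=> zrho; apply: mem_eball; first by lra.
  have := edot_le_sqdist z y; rewrite rE; move: zrho ry; rewrite rE; nra.
have sqyy : sqdist y y = 0.
  by rewrite sqdistE big1// => i _; rewrite subrr expr0n.
have kA : 2 * k * rho < A by rewrite -mulrA kE; lra.
have : u x <= u y + A * Num.sqrt (sqdist y x) - k * sqdist y x.
  apply: (subsol_le_cone beta F u y A k rho) => // z zrho.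
  have := sub_le_osc u r z y cu (yr _ _) (yr _ _).
  rewrite zrho lexx sqyy sqr_ge0 => /(_ isT isT) /le_trans/(_ oscr).
  by rewrite expr2 mulrA kE rE /e'; nra.
have Ae : A * (Num.sqrt (sqdist y x) + 1) = e by rewrite /A divfK// gt_eqF.
have : 0 <= k * sqdist y x by rewrite mulr_ge0 ?sqdist_ge0// ltW.
move: Ae; lra.
Unshelve. all: by end_near. Qed.

End Comparison.

Theorem theorem15 (R : realType) (n : nat) (n_gt0 : (0 < n)%N)
    (beta m lambda gamma alpha : R)
    (beta_ge0 : 0 <= beta) (beta_le2 : beta <= 2)
    (m_gt0 : 0 < m) (m_le : m <= 2 - beta)
    (lambda_ge0 : 0 <= lambda) (gamma_ge0 : 0 <= gamma)
    (alpha_gtN1 : -1 < alpha) (alpha_le0 : alpha <= 0)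
    (a : 'rV[R]_n -> R) (a_gt0 : forall x, 0 < a x)
    (inf_a_gt0 : 0 < inf (range a))
    (u : 'rV[R]_n -> R) (u_cont : continuous u)
    (u_sol : visc_sol beta
       (fun x r p => a x * (enorm x + 1) `^ alpha * enorm p `^ m
                     + lambda * `|r| `^ gamma * expR r) u)
    (u_osc : osc (eball r) u / r @[r --> +oo] --> 0) :
  exists c : R, forall x, u x = c.
Proof.
have [u_subsol _] := u_sol.
have F0 (x : 'rV[R]_n) (r : R) (p : 'rV[R]_n) :
    0 <= a x * (enorm x + 1) `^ alpha * enorm p `^ m
         + lambda * `|r| `^ gamma * expR r.
  by rewrite addr_ge0 ?mulr_ge0 ?powR_ge0 ?expR_ge0// ltW.
exists (u 0) => x; apply/eqP; rewrite eq_le.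
by rewrite !(subsol_sublinear_le _ _ _ _ _ u_cont F0 u_subsol u_osc).
Qed.
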